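(* Let $H$ be a direct summand of $\mathbb{Z}^N$ of rank $N-d$. Then there exists a crystallographic $1$-tight frame $\mathcal{S}=\{{\bf v}_i\}_{i=1}^N$ of $\mathbb{R}^d$ whose vanishing subgroup satisfies $H(\mathcal{S})=H$, and such $\mathcal{S}$ is unique up to congruence.
   Context: A frame of size $N$ in $\mathbb{R}^d$ is a sequence $\mathcal{S}=\{{\bf v}_i\}_{i=1}^N$ of vectors spanning $\mathbb{R}^d$ (zero or parallel vectors are allowed). It is $1$-tight if $\sum_{i=1}^N\langle{\bf x},{\bf v}_i\rangle{\bf v}_i={\bf x}$ for all ${\bf x}\in\mathbb{R}^d$. It is crystallographic if the additive group generated by ${\bf v}_1,\ldots,{\bf v}_N$ is a lattice in $\mathbb{R}^d$. The vanishing subgroup is $H(\mathcal{S})=\{{}^t(k_1,\ldots,k_N)\in\mathbb{Z}^N\mid k_1{\bf v}_1+\cdots+k_N{\bf v}_N={\bf 0}\}$. Two frames $\{{\bf u}_i\}_{i=1}^N$, $\{{\bf v}_i\}_{i=1}^N$ in $\mathbb{R}^d$ are congruent if there is $U\in O(d)$ with ${\bf u}_i=U{\bf v}_i$ for all $i$. A subgroup $B$ of an abelian group $A$ is a direct summand if $A=B\oplus B'$ for some subgroup $B'$. *)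

(* Defs.v *)
From HB Require Import structures.
From mathcomp Require Import all_boot all_order all_algebra.
From mathcomp Require Import boolp classical_sets reals.

Set Implicit Arguments.
Unset Strict Implicit.
Unset Printing Implicit Defensive.

Import Order.TTheory GRing.Theory Num.Theory.
Local Open Scope classical_set_scope.
Local Open Scope ring_scope.

Definition subgroup (A : zmodType) (B : set A) : Prop := zmod_closed [in B].

Definition direct_summand (A : zmodType) (B : set A) : Prop :=
  subgroup B /\
  exists B' : set A,
    [/\ subgroup B',
        forall a, exists b b', [/\ B b, B' b' & a = b + b']
      & B `&` B' = [set 0]].

Definition zindep (A : zmodType) (m : nat) (s : m.-tuple A) : Prop :=
  forall k : 'I_m -> int,
    \sum_(i < m) tnth s i *~ k i = 0 -> forall i, k i = 0.

(* Rank of an abelian group as the largest size of a Z-linearly independent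
   family; for a subgroup of Z^N this is the size of any Z-basis. *)
Definition has_rank (A : zmodType) (B : set A) (r : nat) : Prop :=
  (exists s : r.-tuple A, (forall i, B (tnth s i)) /\ zindep s) /\
  (forall (m : nat) (s : m.-tuple A),
     (forall i, B (tnth s i)) -> zindep s -> (m <= r)%N).

Definition zspan (A : zmodType) (m : nat) (s : m.-tuple A) : set A :=
  [set x | inIntSpan s x].

Definition dotv (R : realType) (d : nat) (x y : 'cV[R]_d) : R :=
  \sum_(j < d) x j 0 * y j 0.

Definition is_frame (R : realType) (d N : nat) (S : N.-tuple 'cV[R]_d) : Prop :=
  (<<S>> = fullv)%VS.

Definition tight1 (R : realType) (d N : nat) (S : N.-tuple 'cV[R]_d) : Prop :=
  forall x : 'cV[R]_d, \sum_(i < N) dotv x (tnth S i) *: tnth S i = x.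

(* Lattices have full rank: they are the Z-spans of the R-bases of R^d. *)
Definition is_lattice (R : realType) (d : nat) (L : set 'cV[R]_d) : Prop :=
  exists b : d.-tuple 'cV[R]_d, basis_of fullv b /\ L = zspan b.

Definition crystallographic (R : realType) (d N : nat)
    (S : N.-tuple 'cV[R]_d) : Prop :=
  is_lattice (zspan S).

Definition vanishing (R : realType) (d N : nat) (S : N.-tuple 'cV[R]_d) :
    set 'cV[int]_N :=
  [set k | \sum_(i < N) tnth S i *~ k i 0 = 0].

Definition congruent (R : realType) (d N : nat) (S T : N.-tuple 'cV[R]_d) :
    Prop :=
  exists U : 'M[R]_d,
    U^T *m U = 1%:M /\ forall i, tnth S i = U *m tnth T i.

Definition crystal_tight_frame (R : realType) (d N : nat)
    (S : N.-tuple 'cV[R]_d) : Prop :=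
  [/\ is_frame S, crystallographic S & tight1 S].

(* Main.v *)
Require Import Defs.
From mathcomp Require Import all_boot all_order all_algebra.
From mathcomp Require Import boolp classical_sets reals.
Local Open Scope classical_set_scope.
Local Open Scope ring_scope.
Import Order.TTheory GRing.Theory Num.Theory.

(** A family of [N] vectors of R^d is the same thing as the d x N matrix [V]
    of its columns, and every notion of the theorem becomes a matrix condition:
    the family is 1-tight iff [V V^T = 1], its vanishing subgroup is the set of
    integer columns [k] with [V k = 0], and the group it generates is
    [V Z^N].

    The heart of the proof is that a direct summand [H] of Z^N of rank [N - d]
    is the kernel of a surjection Z^N -> Z^d ([summand_kernel]): there are
    integer matrices [C] (d x N) and [D] (N x d) with [C D = 1] and
    [H = ker C]. Indeed [H] is the kernel of the projection [P] onto its
    complement. The Smith normal form [P = L Delta Q] with [L] and [Q]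
    unimodular shows that [ker P] is cut out by the rows of [Q] that face a
    nonzero diagonal entry of [Delta], and these rows have the corresponding
    columns of [Q^-1] as a right inverse. Counting dimensions over the
    rationals shows that there are exactly [d] such rows.

    Existence: the rows of [C] are independent over the reals, so the
    Gram-Schmidt process gives an invertible [M] for which the rows of
    [V = M C] are orthonormal. The columns of [V] are then a 1-tight frame;
    as [M] is invertible, [V k = 0] iff [C k = 0]; and [V Z^N = M Z^d] because
    [C] is onto, so that the frame generates the lattice with basis the columns
    of [M].

    Uniqueness: the columns of [1 - D C] lie in [ker C = H]. A matrix [V] that
    kills [H] thus satisfies [V = (V D) C]: two tight frames with vanishing
    subgroup [H] have matrices [A C] and [B C], hence [V = U W] with
    [U = A B^-1], and [1 = V V^T = U W W^T U^T = U U^T]. *)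

(** * Families of vectors as matrices *)

Definition colmx {A : pzRingType} {n m : nat} (s : m.-tuple 'cV[A]_n) :
    'M[A]_(n, m) :=
  \matrix_(i, j) tnth s j i 0.

Definition cols {A : pzRingType} {n m : nat} (M : 'M[A]_(n, m)) :
    m.-tuple 'cV[A]_n :=
  [tuple col j M | j < m].

Lemma col_colmx {A : pzRingType} {n m : nat} (s : m.-tuple 'cV[A]_n) j :
  col j (colmx s) = tnth s j.
Proof. by apply/matrixP => i k; rewrite !mxE ord1. Qed.

Lemma colsK {A : pzRingType} {n m : nat} (M : 'M[A]_(n, m)) :
  colmx (cols M) = M.
Proof. by apply/matrixP => i j; rewrite mxE tnth_mktuple mxE. Qed.

Lemma sum_tnth_mulrz {A : pzRingType} {n m : nat} (s : m.-tuple 'cV[A]_n)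
    (k : 'cV[int]_m) :
  \sum_(i < m) tnth s i *~ k i 0 = colmx s *m map_mx intr k.
Proof.
apply/matrixP => i j; rewrite summxE mxE; apply: eq_bigr => l _.
have -> : tnth s l *~ k l 0 = (k l 0)%:~R *: tnth s l by rewrite scaler_int.
by rewrite !mxE !ord1 mulrzl mulrzr.
Qed.

Lemma map_intz_mx {n m : nat} (M : 'M[int]_(n, m)) : map_mx intr M = M.
Proof. by apply/matrixP => i j; rewrite mxE intz. Qed.

Lemma map_intr_mx_eq0 {F : numDomainType} {n m : nat} (M : 'M[int]_(n, m)) :
  map_mx intr M = 0 :> 'M[F]_(n, m) -> M = 0.
Proof.
move=> /matrixP M0; apply/matrixP => i j; have := M0 i j.
by rewrite !mxE => /eqP; rewrite intr_eq0 => /eqP.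
Qed.

Lemma zspanP {R : realType} {d m : nat} (s : m.-tuple 'cV[R]_d) x :
  zspan s x <-> exists k : 'cV[int]_m, x = colmx s *m map_mx intr k.
Proof.
split=> [[a ->]|[k ->]].
  exists (\col_i a i); rewrite -sum_tnth_mulrz.
  by apply: eq_bigr => i _; rewrite mxE (tnth_nth 0).
exists [ffun i => k i 0]; rewrite -sum_tnth_mulrz.
by apply: eq_bigr => i _; rewrite ffunE (tnth_nth 0).
Qed.

Lemma vanishingE {R : realType} {d N : nat} (S : N.-tuple 'cV[R]_d) :
  vanishing S = [set k | colmx S *m map_mx intr k = 0].
Proof.
by rewrite /vanishing; apply/seteqP; split=> k /=; rewrite sum_tnth_mulrz.
Qed.

(** The frame operator of [S] is multiplication by [V V^T], [V] being the matrix
    of [S]. *)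
Lemma tight1P {R : realType} {d N : nat} (S : N.-tuple 'cV[R]_d) :
  tight1 S <-> colmx S *m (colmx S)^T = 1%:M.
Proof.
have E x : \sum_(i < N) dotv x (tnth S i) *: tnth S i
    = colmx S *m (colmx S)^T *m x.
  rewrite -mulmxA; apply/matrixP => i j; rewrite summxE mxE ord1.
  apply: eq_bigr => l _; rewrite !mxE mulrC; congr (_ * _).
  by apply: eq_bigr => b _; rewrite !mxE mulrC.
split=> [T|T x]; last by rewrite E T mul1mx.
apply/matrixP => i j; have := T (delta_mx j 0); rewrite E -colE.
by move/matrixP/(_ i 0); rewrite !mxE eqxx andbT.
Qed.

(** A right inverse [X] of the matrix of [S] supplies the coefficients: [x] is
    the combination of the vectors of [S] with coefficients [X x]. *)
Lemma span_cols {R : fieldType} {d N : nat} (S : N.-tuple 'cV[R]_d)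
    (X : 'M[R]_(N, d)) :
  colmx S *m X = 1%:M -> (<<S>> = fullv)%VS.
Proof.
move=> SX; apply/eqP; rewrite eqEsubv subvf; apply/subvP => x _.
have -> : x = \sum_(i < N) (X *m x) i 0 *: tnth S i.
  rewrite -[LHS]mul1mx -SX -mulmxA; apply/matrixP => i j.
  by rewrite summxE mxE ord1; apply: eq_bigr => l _; rewrite !mxE mulrC.
by apply: memv_suml => i _; apply/memvZ/memv_span/mem_tnth.
Qed.

(** * Integral independence and rational rank *)

Lemma zindepP {n m : nat} (s : m.-tuple 'cV[int]_n) :
  zindep s <-> forall k : 'cV[int]_m, colmx s *m k = 0 -> k = 0.
Proof.
split=> [ind k Kk|inj k k0 i].
  apply/matrixP => i j; rewrite ord1 mxE; apply: (ind (fun i => k i 0)).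
  by rewrite sum_tnth_mulrz map_intz_mx.
have /inj/matrixP/(_ i 0) : colmx s *m \col_l k l = 0; last by rewrite !mxE.
rewrite -[\col_l k l]map_intz_mx -sum_tnth_mulrz -[RHS]k0.
by apply: eq_bigr => l _; rewrite mxE.
Qed.

Local Notation toQ M := (map_mx (intr : int -> rat) M).

Lemma clear_denominators {m : nat} (u : 'rV[rat]_m) :
  exists2 c : int, c != 0 & exists w : 'rV[int]_m, c%:~R *: u = map_mx intr w.
Proof.
exists (\prod_j denq (u 0 j)).
  by apply/prodf_neq0 => j _; rewrite denq_neq0.
exists (\row_j (numq (u 0 j) * \prod_(i | i != j) denq (u 0 i))).
apply/rowP => j; rewrite !mxE (bigD1 j) //= !intrM.
by rewrite mulrAC [_%:~R * u 0 j]mulrC -numqE.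
Qed.

(** A rational relation becomes an integral one once its denominators are
    cleared. *)
Lemma zindep_row_free {n m : nat} (s : m.-tuple 'cV[int]_n) :
  zindep s -> row_free (map_mx intr (colmx s)^T : 'M[rat]_(m, n)).
Proof.
move=> /zindepP ind; apply: inj_row_free => v v0.
have [c c0 [w wE]] := clear_denominators v.
suff w0 : w = 0.
  move/eqP: wE; rewrite w0 map_mx0 scaler_eq0 intr_eq0 (negPf c0) /=.
  by move/eqP.
apply: trmx_inj; rewrite trmx0; apply: ind; apply: trmx_inj.
rewrite trmx_mul trmxK trmx0.
apply: (@map_intr_mx_eq0 rat).
by rewrite map_mxM -wE -scalemxAl v0 scaler0.
Qed.

(** * Direct summands as kernels of split surjections *)

Lemma subgroupP {A : zmodType} (B : set A) :
  subgroup B -> B 0 /\ forall x y, B x -> B y -> B (x - y).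
Proof.
move=> [B0 BB]; split; first by have := B0; rewrite /= in_setE.
by move=> x y Bx By; have := BB x y; rewrite /= !in_setE; apply.
Qed.

Lemma subgroup_mulmx {n m : nat} (B : set 'cV[int]_n) (M : 'M[int]_(n, m)) :
  subgroup B -> (forall j, B (col j M)) -> forall k : 'cV[int]_m, B (M *m k).
Proof.
move=> /subgroupP[B0 BB] BM k.
have BN x : B x -> B (- x) by move=> Bx; rewrite -sub0r; apply: BB.
have BD x y : B x -> B y -> B (x + y).
  by move=> Bx By; rewrite -[y]opprK; apply/BB/BN.
have BMn x p : B x -> B (x *+ p).
  by move=> Bx; elim: p => [|p IH]; rewrite ?mulr0n // mulrS; apply: BD.
have -> : M *m k = \sum_j col j M *~ k j 0.
  rewrite -[in LHS](colsK M) -[in LHS](map_intz_mx k) -sum_tnth_mulrz.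
  by apply: eq_bigr => i _; rewrite tnth_mktuple.
apply: (big_ind B) => // j _.
case: (k j 0) => p; first exact/BMn.
by rewrite NegzE mulrNz; apply/BN/BMn.
Qed.

(** [P] is the projection of Z^N = H + B' onto the complement [B'] of [H]. It is
    determined by the [B']-components of the unit vectors, which are its
    columns. *)
Lemma summand_projection {N : nat} (H : set 'cV[int]_N) :
  direct_summand H -> exists P : 'M[int]_N, H = [set k | P *m k = 0].
Proof.
move=> [HH [B' [BB' dec HB0]]].
have /choice[b' b'P] (j : 'I_N) : exists y, B' y /\ H (delta_mx j 0 - y).
  by have [x [y [Hx B'y ->]]] := dec (delta_mx j 0); exists y; rewrite addrK.
pose P : 'M[int]_N := \matrix_(i, j) b' j i 0.
have colP j : col j P = b' j by apply/matrixP => i l; rewrite !mxE ord1.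
have BP : forall k : 'cV_N, B' (P *m k).
  by apply: subgroup_mulmx => // j; rewrite colP; case: (b'P j).
have HP : forall k : 'cV_N, H (k - P *m k).
  move=> k; rewrite -[X in X - _]mul1mx -mulmxBl.
  apply: subgroup_mulmx k => // j.
  by rewrite linearB /= colP col1; case: (b'P j).
have [H0 HB] := subgroupP _ HH.
exists P; apply/seteqP; split=> k /= Hk; last first.
  by rewrite -[k]subr0 -Hk.
(* [P k] lies in [B'], and also in [H], as [k - (k - P k)]. *)
have : (H `&` B') (P *m k).
  split; last exact: BP.
  by rewrite -[_ *m _](subKr k); apply: HB.
by rewrite HB0.
Qed.

(** If [P = L Delta Q] is a Smith normal form, [P k = 0] says that the
    coordinates of [Q k] facing a nonzero diagonal entry of [Delta] vanish.
    So [C] collects these rows of [Q], and the same columns of [Q^-1] form a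
    right inverse [D]. *)
Lemma intmx_kernel_split {N : nat} (P : 'M[int]_N) :
  exists r (C : 'M[int]_(r, N)) (D : 'M[int]_(N, r)),
    C *m D = 1%:M /\ forall k : 'cV_N, P *m k = 0 <-> C *m k = 0.
Proof.
have [L Lu [Q Qu [d _ ->]]] := int_Smith_normal_form P.
set Dg := \matrix_(i, j) _.
pose I := [set i : 'I_N | d`_i != 0]%SET.
exists #|I|, (rowsub enum_val Q), (colsub enum_val (invmx Q)); split.
  rewrite mul_rowsub_mx mulmx_colsub mulmxV //.
  by apply/matrixP => i j; rewrite !mxE (inj_eq enum_val_inj).
move=> k; rewrite -!mulmxA mul_rowsub_mx; set v := Q *m k.
have DgE i : (Dg *m v) i 0 = d`_i * v i 0.
  rewrite mxE (bigD1 i) //= mxE eqxx mulr1n big1 ?addr0 // => j ji.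
  by rewrite mxE val_eqE eq_sym (negPf ji) mul0r.
split=> [E|E].
  have Dv : Dg *m v = 0 by rewrite -[LHS](mulKmx Lu) E mulmx0.
  apply/matrixP => i j; rewrite ord1 mxE [RHS]mxE.
  have := DgE (enum_val i); rewrite Dv mxE => /esym/eqP; rewrite mulf_eq0.
  by have := enum_valP i; rewrite inE => /negPf -> /= /eqP.
suff -> : Dg *m v = 0 by rewrite mulmx0.
apply/matrixP => i j; rewrite ord1 DgE [RHS]mxE.
have [->|di] := eqVneq d`_i 0; first by rewrite mul0r.
have iI : i \in I by rewrite inE.
by have := congr1 (fun M : 'cV_ _ => M (enum_rank_in iI i) 0) E;
  rewrite mxE enum_rankK_in // => ->; rewrite mxE mulr0.
Qed.

(** An independent family in [ker C] stays independent over the rationals, where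
    [ker C] has dimension [N - r]: this bounds [q] from above. Conversely
    [1 - D C] maps Z^N into [ker C] and has rational rank at least [N - r], so
    some [N - r] of its columns are independent: this bounds [q] from below. *)
Lemma split_kernel_rank {N r q : nat} (C : 'M[int]_(r, N))
    (D : 'M[int]_(N, r)) :
  C *m D = 1%:M -> has_rank [set k : 'cV[int]_N | C *m k = 0] q ->
  (r + q)%N = N.
Proof.
move=> CD [[s [sC ind]] maxq].
have CDq : toQ C *m toQ D = 1%:M by rewrite -map_mxM CD map_mx1.
have rC : \rank (toQ C) = r by apply/eqP/row_freeP; exists (toQ D).
apply/eqP; rewrite eqn_leq; apply/andP; split.
  have := @mulmx0_rank_max _ _ _ _ (toQ C) (toQ (colmx s)).
  rewrite rC -[\rank (toQ (colmx s))]mxrank_tr map_trmx.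
  rewrite (eqP (zindep_row_free s ind)); apply.
  rewrite -map_mxM; suff -> : C *m colmx s = 0 by rewrite map_mx0.
  apply/matrixP => i j; have /matrixP/(_ i 0) := sC j.
  by rewrite -col_colmx !mxE => E; rewrite -[RHS]E; apply: eq_bigr => l _;
    rewrite !mxE.
pose E := 1%:M - D *m C; pose F := toQ E^T.
have rF : (N - r <= \rank F)%N.
  rewrite leq_subLR addnC -{1}(mxrank1 rat N).
  have -> : 1%:M = F + toQ (D *m C)^T.
    by rewrite /F -raddfD /= -linearD /= subrK trmx1 map_mx1.
  apply: leq_trans (mxrank_add _ _) _; rewrite leq_add2l.
  rewrite trmx_mul map_mxM.
  by apply: leq_trans (mxrankM_maxl _ _) (rank_leq_col _).
rewrite -leq_subLR; apply: leq_trans rF _.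
apply: (maxq _ (cols (colsub (maxrankfun F) E))) => [i|].
  rewrite tnth_mktuple /=; apply/matrixP => a b.
  rewrite colE mulmxA mulmx_colsub mulmxBr mulmx1 mulmxA CD mul1mx subrr.
  by rewrite -colE !mxE.
apply/zindepP => k; rewrite colsK => Ek.
have kF : map_mx intr k^T *m rowsub (maxrankfun F) F = 0.
  have -> : rowsub (maxrankfun F) F = toQ (colsub (maxrankfun F) E)^T.
    by apply/matrixP => a b; rewrite !mxE.
  by rewrite -map_mxM -trmx_mul Ek trmx0 map_mx0.
apply: trmx_inj; rewrite trmx0; apply: (@map_intr_mx_eq0 rat).
by apply: (row_free_inj (maxrowsub_free F)); rewrite kF mul0mx.
Qed.

(** The rank of [H] determines the number of rows of the matrix obtained
    from the Smith normal form. *)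
Lemma summand_kernel {N d : nat} (H : set 'cV[int]_N) :
  (d <= N)%N -> direct_summand H -> has_rank H (N - d) ->
  exists (C : 'M[int]_(d, N)) (D : 'M[int]_(N, d)),
    C *m D = 1%:M /\ H = [set k | C *m k = 0].
Proof.
move=> dN /summand_projection[P ->].
have [r [C [D [CD PC]]]] := intmx_kernel_split P.
have -> : [set k : 'cV_N | P *m k = 0] = [set k | C *m k = 0].
  by apply/seteqP; split=> k /PC.
move=> /(split_kernel_rank _ _ CD) rN.
have dr : r = d by apply/eqP; rewrite -(eqn_add2r (N - d)) rN subnKC.
by subst r; exists C, D.
Qed.

(** * Orthonormalization of the rows of a matrix *)

Lemma row_dot_self_leif {R : realDomainType} {n : nat} (v : 'rV[R]_n) :
  0 <= (v *m v^T) 0 0 ?= iff (v == 0).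
Proof.
have E : (v *m v^T) 0 0 = \sum_j v 0 j ^+ 2.
  by rewrite mxE; apply: eq_bigr => j _; rewrite mxE expr2.
apply/leifP; case: eqVneq => [->|v0]; first by rewrite mul0mx mxE.
rewrite lt_neqAle E sumr_ge0 ?andbT => [|j _]; last exact: sqr_ge0.
apply: contraNneq v0 => /esym/eqP.
rewrite psumr_eq0 => [/allP vj|j _]; last exact: sqr_ge0.
apply/eqP/rowP => j; rewrite [RHS]mxE; apply/eqP.
by have := vj j (mem_index_enum j); rewrite sqrf_eq0.
Qed.

(** Gram-Schmidt, from the bottom row upwards: once the lower rows [B] are
    replaced by orthonormal rows [W = M B], the top row [u] is replaced by its
    component [v = u - u W^T W] orthogonal to [W], rescaled to length 1. It is
    nonzero because [u] is not a combination of the rows of [B]. *)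
Lemma orthonormalize {R : rcfType} {d N : nat} (C : 'M[R]_(d, N)) :
  row_free C -> exists M : 'M[R]_d, (M *m C) *m (M *m C)^T = 1%:M.
Proof.
elim: d C => [|d IH] C freeC.
  by exists 0; apply/matrixP => -[].
change 'M[R]_(1 + d, N) in C.
rewrite -[C]vsubmxK in freeC *.
move: (usubmx C) (dsubmx C) freeC => u B freeC {C}.
have /row_freeP[X XB] := freeC; change 'M[R]_(N, 1 + d) in X.
have freeB : row_free B.
  apply/row_freeP; exists (rsubmx X).
  have : col_mx u B *m row_mx (lsubmx X) (rsubmx X) = block_mx 1%:M 0 0 1%:M.
    by rewrite hsubmxK -scalar_mx_block.
  by rewrite mul_col_row => /eq_block_mx[].
have [M MB] := IH B freeB; set W := M *m B in MB.
pose a := - (u *m W^T *m M); pose v := u + a *m B.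
have vW : v *m W^T = 0.
  by rewrite mulmxDl !mulNmx -(mulmxA _ M B) -/W -(mulmxA _ W) MB mulmx1 subrr.
have v0 : v != 0.
  (* [v = 0] would be a relation between the rows of [col_mx u B] in which [u]
     has coefficient 1. *)
  apply/eqP => v0; have : row_mx 1%:M a *m col_mx u B = 0.
    by rewrite mul_row_col mul1mx.
  rewrite -(mul0mx _ (col_mx u B)) => /(row_free_inj freeC).
  move=> /(congr1 (@lsubmx R 1 1 d)); rewrite row_mxKl => /matrixP/(_ 0 0)/eqP.
  by rewrite !mxE oner_eq0.
set c := (v *m v^T) 0 0.
have c0 : 0 < c by rewrite (lt_leif (row_dot_self_leif v)).
pose t := (Num.sqrt c)^-1.
pose K : 'M[R]_(1 + d) := block_mx t%:M (t *: a) 0 M; exists K.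
change ((K *m col_mx u B) *m (K *m col_mx u B)^T = 1%:M :> 'M[R]_(1 + d)).
have -> : K *m col_mx u B = col_mx (t *: v) W.
  by rewrite mul_block_col mul0mx add0r mul_scalar_mx -scalemxAl -scalerDr.
rewrite tr_col_mx mul_col_row MB (scalar_mx_block 1 d).
have tvW : (t *: v) *m W^T = 0 by rewrite -scalemxAl vW scaler0.
congr block_mx; last 2 first => //.
- by apply: trmx_inj; rewrite trmx_mul trmxK tvW !trmx0.
rewrite linearZ /= -scalemxAl -scalemxAr scalerA -expr2 exprVn sqr_sqrtr ?ltW //
  [v *m v^T]mx11_scalar -/c scale_scalar_mx mulVf //.
by rewrite gt_eqF.
Qed.

(** * Existence and uniqueness of the frame *)

(** The frame is [M C], where [M] orthonormalizes the rows of [C]. It generates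
    [M C Z^N = M Z^d], since [C] is onto. *)
Lemma frame_of_kernel {R : realType} {d N : nat} (C : 'M[int]_(d, N))
    (D : 'M[int]_(N, d)) :
  C *m D = 1%:M ->
  exists S : N.-tuple 'cV[R]_d,
    crystal_tight_frame S /\ vanishing S = [set k | C *m k = 0].
Proof.
move=> CD; pose Cr : 'M[R]_(d, N) := map_mx intr C.
have freeC : row_free Cr.
  by apply/row_freeP; exists (map_mx intr D); rewrite -map_mxM CD map_mx1.
have [M MC] := orthonormalize Cr freeC.
have Mu : M \in unitmx.
  by move: MC; rewrite -mulmxA => /mulmx1_unit[].
exists (cols (M *m Cr)); split; last first.
  rewrite vanishingE colsK; apply/seteqP; split=> k /=; last first.
    by move=> Ck; rewrite -mulmxA -map_mxM Ck map_mx0 mulmx0.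
  rewrite -mulmxA => /(congr1 (mulmx (invmx M))).
  by rewrite mulKmx // mulmx0 -map_mxM => /map_intr_mx_eq0.
split; last by apply/tight1P; rewrite colsK.
  by apply: (span_cols _ ((M *m Cr)^T)); rewrite colsK.
exists (cols M); split.
  rewrite basisEdim (span_cols _ (invmx M)) ?colsK ?mulmxV // subvv /=.
  by rewrite size_tuple card_ord dimvf dim_matrix mulr1.
apply/seteqP; split=> x /zspanP[k ->]; apply/zspanP; rewrite !colsK.
  by exists (C *m k); rewrite map_mxM mulmxA.
exists (D *m k); rewrite !map_mxM -!mulmxA [Cr *m _]mulmxA -map_mxM CD.
by rewrite map_mx1 mul1mx.
Qed.

(** The columns of [1 - D C] lie in [ker C], so the matrix of [S] kills them. *)
Lemma factor_through_kernel {R : realType} {d N : nat} (C : 'M[int]_(d, N))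
    (D : 'M[int]_(N, d)) (S : N.-tuple 'cV[R]_d) :
  C *m D = 1%:M -> vanishing S = [set k | C *m k = 0] ->
  colmx S = colmx S *m map_mx intr D *m map_mx intr C.
Proof.
move=> CD; rewrite vanishingE => /seteqP[_ CS].
apply/eqP; rewrite -subr_eq0 -mulmxA -map_mxM -{1}[colmx S]mulmx1 -mulmxBr.
rewrite -(map_mx1 intr) -map_mxB; apply/eqP/matrixP => i j.
have /CS/matrixP/(_ i 0) : [set k | C *m k = 0] (col j (1%:M - D *m C)).
  by rewrite /= colE mulmxA mulmxBr mulmx1 mulmxA CD mul1mx subrr mul0mx.
by rewrite map_col colE mulmxA -colE [LHS]mxE => ->; rewrite !mxE.
Qed.

(** If [V = A C] and [W = B C] have orthonormal rows, [B] is invertible, and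
    [U = A B^-1] takes [W] to [V]; then [U U^T = U W W^T U^T = V V^T = 1]. *)
Lemma tight_frames_congruent {R : realType} {d N : nat}
    (S T : N.-tuple 'cV[R]_d) (A B : 'M[R]_d) (C : 'M[R]_(d, N)) :
  tight1 S -> tight1 T -> colmx S = A *m C -> colmx T = B *m C ->
  congruent S T.
Proof.
move=> /tight1P SS /tight1P TT SA TB.
have Bu : B \in unitmx by move: TT; rewrite TB -mulmxA => /mulmx1_unit[].
pose U := A *m invmx B.
have SU : colmx S = U *m colmx T by rewrite TB mulmxA mulmxKV.
exists U; split; last by move=> i; rewrite -!col_colmx SU !colE mulmxA.
apply: mulmx1C; rewrite -SS SU (trmx_mul U (colmx T)) mulmxA.
by rewrite -(mulmxA U (colmx T)) TT mulmx1.
Qed.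

Theorem proposition4p1 (R : realType) (d N : nat) (hdN : (d <= N)%N)
    (H : set 'cV[int]_N) (Hsummand : direct_summand H)
    (Hrank : has_rank H (N - d)%N) :
  (exists S : N.-tuple 'cV[R]_d, crystal_tight_frame S /\ vanishing S = H) /\
  (forall S T : N.-tuple 'cV[R]_d,
     crystal_tight_frame S -> vanishing S = H ->
     crystal_tight_frame T -> vanishing T = H ->
     congruent S T).
Proof.
have [C [D [CD ->]]] := summand_kernel H hdN Hsummand Hrank.
split; first exact: frame_of_kernel CD.
move=> S T [_ _ tS] vS [_ _ tT] vT.
exact: tight_frames_congruent tS tT (factor_through_kernel _ _ _ CD vS)
  (factor_through_kernel _ _ _ CD vT).
Qed.
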